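(* Let $\mathcal{M}$ be a semi-closed multicategory. Then $\mathsf{Split}(\mathcal{M})$ is a closed multicategory (i.e. it admits objects $[(A,a),(B,b)]$ and evaluation morphisms making it a closed multicategory).
   Context: **Multicategories.** A multicategory $\mathcal{M}$ (planar, i.e. with no symmetric group actions) has a set $\mathcal{M}_0$ of objects, sets $\mathcal{M}(A_1,\ldots,A_n;B)$ of morphisms for all $n\ge 0$, associative composition $f\circ(g_1,\ldots,g_n)$, and unital identities $1_A\in\mathcal{M}(A;A)$; we write $f\circ g$ for $f\circ(g)$. **Semi-closed multicategory.** A multicategory $\mathcal{M}$ together with an object $[A,B]$ and a morphism $\mathsf{ev}_{A,B}\in\mathcal{M}([A,B],A;B)$ for all $A,B\in\mathcal{M}_0$, such that there exist mappings $\Lambda^\Gamma_{A,B}:\mathcal{M}(\Gamma,A;B)\to\mathcal{M}(\Gamma;[A,B])$ for all finite sequences $\Gamma$ of objects and all $A,B$ satisfying: $\mathsf{ev}_{A,B}\circ(\Lambda^\Gamma_{A,B}(f),1_A)=f$ for all $f\in\mathcal{M}(\Gamma,A;B)$; and for $\Gamma=A_1,\ldots,A_n$, $g\in\mathcal{M}(\Gamma,A;B)$ and $f_i\in\mathcal{M}(\Gamma_i;A_i)$, $\Lambda^{\Gamma_1,\ldots,\Gamma_n}_{A,B}(g\circ(f_1,\ldots,f_n,1_A))=\Lambda^\Gamma_{A,B}(g)\circ(f_1,\ldots,f_n)$. **Closed multicategory.** A multicategory $\mathcal{M}$ together with an object $[A,B]$ and a morphism $\mathsf{ev}_{A,B}\in\mathcal{M}([A,B],A;B)$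 for all $A,B\in\mathcal{M}_0$, such that for every finite sequence $\Gamma$ of objects the mapping $\mathcal{M}(\Gamma;[A,B])\to\mathcal{M}(\Gamma,A;B)$, $g\mapsto\mathsf{ev}_{A,B}\circ(g,1_A)$, has an inverse. **Idempotent splitting.** For a multicategory $\mathcal{M}$, $\mathsf{Split}(\mathcal{M})$ is the multicategory whose objects are pairs $(A,a)$ with $A\in\mathcal{M}_0$ and $a\in\mathcal{M}(A;A)$ with $a\circ a=a$; morphisms $(A_1,a_1),\ldots,(A_n,a_n)\to(B,b)$ are those $f\in\mathcal{M}(A_1,\ldots,A_n;B)$ with $b\circ f\circ(a_1,\ldots,a_n)=f$; the identity on $(A,a)$ is $a$; composition is that of $\mathcal{M}$. *)

(* Defs.v *)
From Stdlib Require Import JMeq ProofIrrelevance.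
From mathcomp Require Import all_boot.

Set Implicit Arguments.
Unset Strict Implicit.
Unset Printing Implicit Defensive.

(* The objects and the morphisms of a multicategory form sets.  Accordingly the
   proofs below use [JMeq_eq] (all proofs of an equality of domains induce the
   same cast) and [proof_irrelevance] (a morphism of the idempotent splitting is
   determined by its underlying morphism). *)

(* [hlist T [:: i_1; ..; i_n] [:: j_1; ..; j_n]] is the type of families
   (x_1, ..., x_n) with x_k : T i_k j_k. *)

Inductive hlist {I J : Type} (T : I -> J -> Type) : seq I -> seq J -> Type :=
| hnil : hlist T [::] [::]
| hcons i j s t : T i j -> hlist T s t -> hlist T (i :: s) (j :: t).

Arguments hnil {I J T}.

Section HeterogeneousLists.
Variables (I J : Type) (T : I -> J -> Type).

Definition hone i j (x : T i j) : hlist T [:: i] [:: j] := hcons x hnil.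

Fixpoint hcat s1 t1 s2 t2 (xs : hlist T s1 t1) (ys : hlist T s2 t2) :
    hlist T (s1 ++ s2) (t1 ++ t2) :=
  match xs in hlist _ s t return hlist T (s ++ s2) (t ++ t2) with
  | hnil => ys
  | hcons _ _ _ _ x xs' => hcons x (hcat xs' ys)
  end.

Fixpoint hflatten ss ts (xss : hlist (hlist T) ss ts) :
    hlist T (flatten ss) (flatten ts) :=
  match xss in hlist _ ss ts return hlist T (flatten ss) (flatten ts) with
  | hnil => hnil
  | hcons _ _ _ _ xs xss' => hcat xs (hflatten xss')
  end.

End HeterogeneousLists.

Section Map.
Variables (I J I' J' : Type) (T : I -> J -> Type) (T' : I' -> J' -> Type).
Variables (p : I -> I') (q : J -> J').
Variable h : forall i j, T i j -> T' (p i) (q j).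

Fixpoint hmap s t (xs : hlist T s t) : hlist T' (map p s) (map q t) :=
  match xs in hlist _ s t return hlist T' (map p s) (map q t) with
  | hnil => hnil
  | hcons _ _ _ _ x xs' => hcons (h x) (hmap xs')
  end.

End Map.

Definition cast_dom {I J} {T : I -> J -> Type} {i i' : I} {j : J}
    (e : i = i') (x : T i j) : T i' j :=
  match e in _ = i' return T i' j with erefl => x end.

Lemma flatten_flatten I (isss : seq (seq (seq I))) :
  flatten [seq flatten iss | iss <- isss] = flatten (flatten isss).
Proof. by elim: isss => //= iss isss ->; rewrite flatten_cat. Qed.

Lemma flatten_cat1 I (iss : seq (seq I)) (s : seq I) :
  flatten (iss ++ [:: s]) = flatten iss ++ s.
Proof. by rewrite flatten_cat /= cats0. Qed.

Section Operations.
Variables (O : Type) (H : seq O -> O -> Type).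

Definition composition :=
  forall Gs As B, H As B -> hlist H Gs As -> H (flatten Gs) B.

Variable c : composition.

Definition comp1_with G A B (f : H [:: A] B) (g : H G A) : H G B :=
  cast_dom (cats0 G) (c f (hone g)).

Definition precomp_with As B (f : H As B)
    (us : hlist H [seq [:: A] | A <- As] As) : H As B :=
  cast_dom (flatten_seq1 As) (c f us).

(* From (g_1, ..., g_n) and (hs_1, ..., hs_n), where hs_i is a family of
   morphisms into the domain of g_i, the family of all g_i o hs_i.  The return
   clauses only serve to rule out lists of different lengths. *)
Fixpoint comps_with Gs As (gs : hlist H Gs As) :
    forall Tss, hlist (hlist H) Tss Gs ->
      hlist H [seq flatten Ts | Ts <- Tss] As :=
  match gs in hlist _ Gs As
    return forall Tss, hlist (hlist H) Tss Gs ->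
      hlist H [seq flatten Ts | Ts <- Tss] As with
  | hnil => fun _ hss =>
      match hss in hlist _ Tss Gs
        return match Gs with
               | [::] => hlist H [seq flatten Ts | Ts <- Tss] [::]
               | _ => unit
               end with
      | hnil => hnil
      | hcons _ _ _ _ _ _ => tt
      end
  | @hcons _ _ _ G A Gs' As' g gs' => fun _ hss =>
      match hss in hlist _ Tss Gs
        return match Gs with
               | [::] => unit
               | G :: Gs' => H G A ->
                   (forall Tss, hlist (hlist H) Tss Gs' ->
                      hlist H [seq flatten Ts | Ts <- Tss] As') ->
                   hlist H [seq flatten Ts | Ts <- Tss] (A :: As')
               end with
      | hnil => tt
      | hcons _ _ _ _ hs hss' => fun g rec => hcons (c g hs) (rec _ hss')
      end g (comps_with gs')
  end.

Fixpoint unaries (u : forall A, H [:: A] A) (As : seq O) :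
    hlist H [seq [:: A] | A <- As] As :=
  match As with
  | [::] => hnil
  | A :: As' => hcons (u A) (unaries u As')
  end.

End Operations.

(* [multicomp f (g_1, ..., g_n)] is f o (g_1, ..., g_n); its domain is the
   concatenation of the domains of the g_i.  The two sides of each law have
   domains that are provably but not definitionally equal, whence the casts. *)
Record multicategory := Multicategory {
  obj :> Type;
  mor : seq obj -> obj -> Type;
  idm : forall A, mor [:: A] A;
  multicomp : composition mor;
  multicompA : forall Tss Gs As B (f : mor As B) (gs : hlist mor Gs As)
      (hss : hlist (hlist mor) Tss Gs),
    multicomp (multicomp f gs) (hflatten hss)
    = cast_dom (flatten_flatten Tss)
        (multicomp f (comps_with multicomp gs hss));
  multicomp1m : forall G B (f : mor G B),
    comp1_with multicomp (idm B) f = f;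
  multicompm1 : forall As B (f : mor As B),
    precomp_with multicomp f (unaries idm As) = f
}.

Arguments mor {m} _ _.
Arguments idm {m} A.
Arguments multicomp {m Gs As B} f gs.

Section Theory.
Variable M : multicategory.

Definition comp1 G (A B : M) (f : mor [:: A] B) (g : mor G A) : mor G B :=
  comp1_with (@multicomp M) f g.

Definition precomp (As : seq M) B (f : mor As B)
    (us : hlist mor [seq [:: A] | A <- As] As) : mor As B :=
  precomp_with (@multicomp M) f us.

Record exponentials := Exponentials {
  ihom : M -> M -> M;
  ev : forall A B, mor [:: ihom A B; A] B
}.

(* The map g |-> ev o (g, 1_A); flatten [:: G; [:: A]] is convertible to
   G ++ [:: A], which encodes the sequence G, A. *)
Definition eval_with (E : exponentials) G A B (g : mor G (ihom E A B)) :
    mor (G ++ [:: A]) B :=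
  multicomp (ev E A B) (hcons g (hone (idm A))).

Definition semi_closed (E : exponentials) : Prop :=
  exists Lam : forall G A B, mor (G ++ [:: A]) B -> mor G (ihom E A B),
    (forall G A B (f : mor (G ++ [:: A]) B), eval_with (Lam G A B f) = f) /\
    (forall Gs G A B (g : mor (G ++ [:: A]) B) (fs : hlist mor Gs G),
       Lam (flatten Gs) A B
         (cast_dom (flatten_cat1 Gs [:: A])
            (multicomp g (hcat fs (hone (idm A)))))
       = multicomp (Lam G A B g) fs).

Definition closed (E : exponentials) : Prop :=
  forall G A B, bijective (@eval_with E G A B).

End Theory.

Local Notation "x ~= y" := (JMeq x y) (at level 70).

Section Heterogeneous.

Lemma cast_dom_JMeq I J (T : I -> J -> Type) i i' j (e : i = i') (x : T i j) :
  cast_dom e x ~= x.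
Proof. by case: i' / e. Qed.

Lemma cast_domP I J (T : I -> J -> Type) i i' j (e : i = i') (x : T i j)
  (y : T i' j) : x ~= y -> cast_dom e x = y.
Proof. by case: i' / e y => y h; apply: JMeq_eq. Qed.

Lemma hcons_JMeq I J (T : I -> J -> Type) i i' j j' s s' t t'
    (x : T i j) (x' : T i' j') (xs : hlist T s t) (xs' : hlist T s' t') :
  i = i' -> j = j' -> s = s' -> t = t' -> x ~= x' -> xs ~= xs' ->
  hcons x xs ~= hcons x' xs'.
Proof. by move=> ? ? ? ?; subst=> hx hy; rewrite (JMeq_eq hx) (JMeq_eq hy). Qed.

Lemma hcat_JMeq I J (T : I -> J -> Type) s1 s1' t1 t1' s2 s2' t2 t2'
    (x : hlist T s1 t1) (x' : hlist T s1' t1')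
    (y : hlist T s2 t2) (y' : hlist T s2' t2') :
  s1 = s1' -> t1 = t1' -> s2 = s2' -> t2 = t2' -> x ~= x' -> y ~= y' ->
  hcat x y ~= hcat x' y'.
Proof. by move=> ? ? ? ?; subst=> hx hy; rewrite (JMeq_eq hx) (JMeq_eq hy). Qed.

Lemma hlist_nilP I J (T : I -> J -> Type) s (xs : hlist T s [::]) :
  s = [::] /\ xs ~= @hnil _ _ T.
Proof.
refine (match xs as xs in hlist _ s t return
  (match t return hlist T s t -> Prop with
   | [::] => fun xs => s = [::] /\ xs ~= @hnil _ _ T | _ => fun=> True end) xs
  with hnil => _ | hcons _ _ _ _ _ _ => Logic.I end) => /=; by split.
Qed.

Lemma hlist_consP I J (T : I -> J -> Type) s j t (xs : hlist T s (j :: t)) :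
  exists i s' (e : i :: s' = s) (x : T i j) (xs' : hlist T s' t),
    xs = cast_dom e (hcons x xs').
Proof.
refine (match xs as xs in hlist _ s t return
  (match t return hlist T s t -> Prop with
   | [::] => fun=> True
   | j :: t => fun xs => exists i s' (e : i :: s' = s) (x : T i j)
       (xs' : hlist T s' t), xs = cast_dom e (hcons x xs') end) xs
  with hnil => Logic.I | @hcons _ _ _ i j s t x xs' => _ end) => /=.
by exists i, s, erefl, x, xs'.
Qed.

Variable M : multicategory.

Lemma multicomp_JMeq Gs Gs' (As As' : seq M) B (f : mor As B) (f' : mor As' B)
    (gs : hlist mor Gs As) (gs' : hlist mor Gs' As') :
  Gs = Gs' -> As = As' -> f ~= f' -> gs ~= gs' ->
  multicomp f gs ~= multicomp f' gs'.
Proof. by move=> ? ?; subst=> hx hy; rewrite (JMeq_eq hx) (JMeq_eq hy). Qed.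

Lemma comp1_JMeq G (A B : M) (f : mor [:: A] B) (g : mor G A) :
  comp1 f g ~= multicomp f (hone g).
Proof. exact: cast_dom_JMeq. Qed.

Lemma precomp_JMeq (As : seq M) B (f : mor As B) us :
  precomp f us ~= multicomp f us.
Proof. exact: cast_dom_JMeq. Qed.

Lemma multicompA_JMeq Tss Gs As B (f : mor As B) (gs : hlist (@mor M) Gs As)
    (hss : hlist (hlist mor) Tss Gs) :
  multicomp (multicomp f gs) (hflatten hss)
  ~= multicomp f (comps_with (@multicomp M) gs hss).
Proof. rewrite multicompA; exact: cast_dom_JMeq. Qed.

Lemma hcats0_JMeq I J (T : I -> J -> Type) s t (xs : hlist T s t) :
  hcat xs hnil ~= xs.
Proof.
elim: xs => //= i j s' t' x xs IH.
by apply: hcons_JMeq => //; rewrite cats0.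
Qed.

Lemma comp1_multicomp Gs As (A B : M) (f : mor [:: A] B) (g : mor As A)
    (hs : hlist mor Gs As) :
  comp1 f (multicomp g hs) = multicomp (comp1 f g) hs.
Proof.
apply: cast_domP.
have := multicompA_JMeq f (hone g) (hone hs) => /= h.
apply: (JMeq_trans (JMeq_sym h)).
apply: multicomp_JMeq; rewrite ?cats0 //.
  exact: (JMeq_sym (comp1_JMeq f g)).
exact: hcats0_JMeq.
Qed.

Lemma comp1_cast G G' (A B : M) (f : mor [:: A] B) (e : G = G') (g : mor G A) :
  comp1 f (cast_dom e g) = cast_dom e (comp1 f g).
Proof. by case: G' / e. Qed.

Lemma comp1A G (A B C : M) (f : mor [:: B] C) (g : mor [:: A] B) (h : mor G A) :
  comp1 f (comp1 g h) = comp1 (comp1 f g) h.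
Proof.
rewrite -[comp1 g h]/(cast_dom (cats0 G) (multicomp g (hone h))).
rewrite comp1_cast.
have e := congr1 (cast_dom (cats0 G)) (comp1_multicomp f g (hone h)); exact: e.
Qed.

Lemma comp1_precomp (As : seq M) (A B : M) (f : mor [:: A] B) (g : mor As A) us :
  comp1 f (precomp g us) = precomp (comp1 f g) us.
Proof. by rewrite /precomp /precomp_with comp1_cast comp1_multicomp. Qed.

End Heterogeneous.

Section Splitting.
Variable M : multicategory.

Record idempotent := Idempotent {
  car : M;
  idem : mor [:: car] car;
  idemK : comp1 idem idem = idem
}.

Fixpoint idems (Xs : seq idempotent) :
    hlist mor [seq [:: A] | A <- map car Xs] (map car Xs) :=
  match Xs with
  | [::] => hnil
  | X :: Xs' => hcons (idem X) (idems Xs')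
  end.

Definition split_mor (Xs : seq idempotent) (Y : idempotent) : Type :=
  {f : mor (map car Xs) (car Y) | comp1 (idem Y) (precomp f (idems Xs)) = f}.

Definition forget Xss Ys (fs : hlist split_mor Xss Ys) :
    hlist mor (map (map car) Xss) (map car Ys) :=
  hmap (fun Xs Y (f : split_mor Xs Y) => sval f) fs.

Lemma split_mor_inj Xs Y (f g : split_mor Xs Y) : sval f = sval g -> f = g.
Proof.
case: f g => [f Pf] [g Pg] /= e; case: g / e Pg => Pg.
by rewrite (proof_irrelevance _ Pf Pg).
Qed.

Lemma idem_multicomp X : multicomp (idem X) (hone (idem X)) = idem X.
Proof.
apply: JMeq_eq; rewrite -[X in _ ~= X]idemK.
exact: JMeq_sym (comp1_JMeq _ _).
Qed.

Fixpoint idem_ones (Xs : seq idempotent) :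
    hlist (hlist mor) [seq [:: [:: A]] | A <- map car Xs]
      [seq [:: A] | A <- map car Xs] :=
  match Xs with
  | [::] => hnil
  | X :: Xs' => hcons (hone (idem X)) (idem_ones Xs')
  end.

Lemma hflatten_idem_ones Xs : hflatten (idem_ones Xs) ~= idems Xs.
Proof.
elim: Xs => //= X Xs IH.
by apply: hcons_JMeq => //; elim: (Xs) => //= ? ? ->.
Qed.

Lemma hcomp_idem_ones Xs :
  comps_with (@multicomp M) (idems Xs) (idem_ones Xs)
  ~= idems Xs.
Proof.
elim: Xs => //= X Xs IH.
apply: hcons_JMeq => //; first by elim: (Xs) => //= ? ? ->.
by rewrite idem_multicomp.
Qed.

Lemma precomp_idems Xs B (f : mor (map car Xs) B) :
  precomp (precomp f (idems Xs)) (idems Xs) = precomp f (idems Xs).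
Proof.
apply: cast_domP; apply: JMeq_sym.
apply: (JMeq_trans (precomp_JMeq _ _)).
have h := multicompA_JMeq f (idems Xs) (idem_ones Xs).
apply: (@JMeq_trans _ _ _ _ (multicomp f
   (comps_with (@multicomp M) (idems Xs) (idem_ones Xs)))).
  apply: multicomp_JMeq => //; last exact: JMeq_sym (hcomp_idem_ones Xs).
  by elim: (Xs) => //= ? ? ->.
apply: (JMeq_trans (JMeq_sym h)).
apply: multicomp_JMeq.
- by elim: (Xs) => //= ? ? ->.
- by rewrite flatten_seq1.
- exact: JMeq_sym (precomp_JMeq _ _).
- exact: hflatten_idem_ones.
Qed.

Lemma split_mor_idl Xs Y (f : split_mor Xs Y) :
  comp1 (idem Y) (sval f) = sval f.
Proof. by case: f => f /= <-; rewrite comp1A idemK. Qed.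

Lemma split_mor_idr Xs Y (f : split_mor Xs Y) :
  precomp (sval f) (idems Xs) = sval f.
Proof.
case: f => f /= Pf; rewrite -{1}Pf -comp1_precomp precomp_idems; exact: Pf.
Qed.

Fixpoint idemss (Xss : seq (seq idempotent)) :
    hlist (hlist mor) [seq [seq [:: A] | A <- map car Xs] | Xs <- Xss]
      (map (map car) Xss) :=
  match Xss with
  | [::] => hnil
  | Xs :: Xss' => hcons (idems Xs) (idemss Xss')
  end.

Lemma idems_cat Xs Ys : idems (Xs ++ Ys) ~= hcat (idems Xs) (idems Ys).
Proof. by elim: Xs => //= X Xs IH; apply: hcons_JMeq; rewrite ?map_cat. Qed.

Lemma hflatten_idemss Xss : hflatten (idemss Xss) ~= idems (flatten Xss).
Proof.
elim: Xss => //= Xs Xss IH; apply: JMeq_sym.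
apply: (JMeq_trans (idems_cat _ _)).
by apply: hcat_JMeq => //; [rewrite map_flatten map_flatten -map_comp
  | rewrite map_flatten | apply: JMeq_sym].
Qed.

Lemma hcomp_idemss Xss Ys (gs : hlist split_mor Xss Ys) :
  comps_with (@multicomp M) (forget gs) (idemss Xss)
  ~= forget gs.
Proof.
elim: gs => //= Xs Y Xss' Ys' g gs IH.
apply: hcons_JMeq => //; first exact: flatten_seq1.
  by elim: (Xss') => //= ? ? ->; rewrite flatten_seq1.
rewrite -[X in _ ~= X]split_mor_idr; exact: JMeq_sym (precomp_JMeq _ _).
Qed.

Lemma split_comp_subproof Xss Ys Z (f : split_mor Ys Z)
    (gs : hlist split_mor Xss Ys)
    (fgs := cast_dom (esym (map_flatten car Xss))
              (multicomp (sval f) (forget gs))) :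
  comp1 (idem Z) (precomp fgs (idems (flatten Xss))) = fgs.
Proof.
have -> : precomp fgs (idems (flatten Xss)) = fgs.
  apply: cast_domP; rewrite /fgs; apply: JMeq_sym.
  apply: (JMeq_trans (cast_dom_JMeq _ _)).
  have h := multicompA_JMeq (sval f) (forget gs) (idemss Xss).
  apply: (@JMeq_trans _ _ _ _ (multicomp (multicomp (sval f) (forget gs))
     (hflatten (idemss Xss)))).
    apply: JMeq_sym; apply: (JMeq_trans h).
    apply: multicomp_JMeq => //; last exact: hcomp_idemss.
    by elim: (Xss) => //= ? ? ->; rewrite flatten_seq1.
  apply: multicomp_JMeq.
  - by rewrite map_flatten map_flatten -map_comp.
  - by rewrite map_flatten.
  - exact: JMeq_sym (cast_dom_JMeq _ _).
  - exact: hflatten_idemss.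
by rewrite /fgs comp1_cast comp1_multicomp split_mor_idl.
Qed.

Definition split_comp : composition split_mor := fun Xss Ys Z f gs =>
  exist _ (cast_dom (esym (map_flatten car Xss))
             (multicomp (sval f) (forget gs)))
    (split_comp_subproof f gs).

Lemma split_id_subproof X :
  comp1 (idem X) (@precomp M (map car [:: X]) _ (idem X) (idems [:: X]))
  = idem X.
Proof.
have -> : @precomp M (map car [:: X]) _ (idem X) (idems [:: X]) = idem X.
  by apply: cast_domP; rewrite /= -/(hone _) idem_multicomp.
exact: idemK.
Qed.

Definition split_id X : split_mor [:: X] X :=
  exist _ (idem X) (split_id_subproof X).

Lemma sval_cast_dom Xs Xs' Y (e : Xs = Xs') (f : split_mor Xs Y) :
  sval (cast_dom e f) ~= sval f.
Proof. by case: Xs' / e. Qed.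

Lemma sval_split_comp Xss Ys Z (f : split_mor Ys Z)
    (gs : hlist split_mor Xss Ys) :
  sval (split_comp f gs) ~= multicomp (sval f) (forget gs).
Proof. exact: cast_dom_JMeq. Qed.

Lemma forget_cat Xss Ys Xss' Ys' (fs : hlist split_mor Xss Ys)
    (gs : hlist split_mor Xss' Ys') :
  forget (hcat fs gs) ~= hcat (forget fs) (forget gs).
Proof.
by elim: fs => //= Xs Y Xss1 Ys1 f fs IH; apply: hcons_JMeq; rewrite ?map_cat.
Qed.

Definition forgets Xsss Yss (fss : hlist (hlist split_mor) Xsss Yss) :
    hlist (hlist mor) (map (map (map car)) Xsss) (map (map car) Yss) :=
  hmap (p := map (map car)) (q := map car) forget fss.

Lemma forget_flatten Xsss Yss (fss : hlist (hlist split_mor) Xsss Yss) :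
  forget (hflatten fss) ~= hflatten (forgets fss).
Proof.
elim: fss => //= Xss Ys Xsss' Yss' fs fss IH.
apply: (JMeq_trans (forget_cat _ _)).
by apply: hcat_JMeq => //; rewrite map_flatten.
Qed.

Lemma forget_hcomp Xsss Yss Zs (gs : hlist split_mor Yss Zs)
    (hss : hlist (hlist split_mor) Xsss Yss) :
  forget (comps_with split_comp gs hss)
  ~= comps_with (@multicomp M) (forget gs) (forgets hss).
Proof.
elim: gs Xsss hss => [|Ys Z Yss' Zs' g gs IH] Xsss hss.
  by case: (hlist_nilP hss) => e; subst=> h; rewrite (JMeq_eq h).
have [Xss [Xsss' [e [hs [hss' ->]]]]] := hlist_consP hss.
case: Xsss / e hss => _ /=.
apply: hcons_JMeq => //.
- by rewrite map_flatten.
- by rewrite -!map_comp; apply: eq_map => ? /=; rewrite map_flatten.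
- exact: sval_split_comp.
Qed.

Lemma split_compA Tss Gs As B (f : split_mor As B) (gs : hlist split_mor Gs As)
    (hss : hlist (hlist split_mor) Tss Gs) :
  split_comp (split_comp f gs) (hflatten hss)
  = cast_dom (flatten_flatten Tss)
      (split_comp f (comps_with split_comp gs hss)).
Proof.
apply: split_mor_inj; apply: JMeq_eq.
apply: (JMeq_trans (sval_split_comp _ _)).
apply: JMeq_sym; apply: (JMeq_trans (sval_cast_dom _ _)).
apply: (JMeq_trans (sval_split_comp _ _)).
have h := multicompA_JMeq (sval f) (forget gs) (forgets hss).
apply: (@JMeq_trans _ _ _ _ (multicomp (sval f)
   (comps_with (@multicomp M) (forget gs) (forgets hss)))).
  apply: multicomp_JMeq => //; last exact: forget_hcomp.
  by rewrite -!map_comp; apply: eq_map => ? /=; rewrite map_flatten.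
apply: (JMeq_trans (JMeq_sym h)).
apply: multicomp_JMeq.
- by rewrite map_flatten.
- by rewrite map_flatten.
- exact: JMeq_sym (sval_split_comp _ _).
- exact: JMeq_sym (forget_flatten _).
Qed.

Lemma split_comp1m G B (f : split_mor G B) :
  comp1_with split_comp (split_id B) f = f.
Proof.
apply: split_mor_inj; apply: JMeq_eq.
apply: (JMeq_trans (sval_cast_dom (cats0 G) (split_comp (split_id B) (hone f)))).
have h := sval_split_comp (split_id B) (hone f); apply: (JMeq_trans h).
rewrite -[X in _ ~= X]split_mor_idl; exact: JMeq_sym (comp1_JMeq _ _).
Qed.

Lemma forget_unaries Xs : forget (unaries split_id Xs) ~= idems Xs.
Proof.
by elim: Xs => //= X Xs IH; apply: hcons_JMeq => //; rewrite -!map_comp.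
Qed.

Lemma split_compm1 As B (f : split_mor As B) :
  precomp_with split_comp f (unaries split_id As) = f.
Proof.
apply: split_mor_inj; apply: JMeq_eq.
apply: (JMeq_trans (sval_cast_dom _ _)).
apply: (JMeq_trans (sval_split_comp _ _)).
rewrite -[X in _ ~= X]split_mor_idr.
apply: JMeq_sym; apply: (JMeq_trans (precomp_JMeq _ _)).
apply: multicomp_JMeq => //; first by rewrite -!map_comp.
exact: JMeq_sym (forget_unaries _).
Qed.

Definition Split : multicategory :=
  Multicategory split_compA split_comp1m split_compm1.

End Splitting.

(* Main.v *)
(* In Split M the exponential of (A, a) and (B, b) is ([A, B], e), where
   t = b o ev o (1, a) and e = Lam t, with t itself as evaluation.  Naturality of
   Lam gives Lam (b o ev o (g, a)) = e o g, and ev o (e o g, h) = t o (g, h).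
   Hence g = e o g is recovered from t o (g, a) by applying Lam; the inverse is
   taken to be f |-> e o Lam f o (c_1, ..., c_n), for c_i the idempotents of the
   domain, since composing with e and the c_i makes it a morphism of Split M. *)
From Stdlib Require Import JMeq.
From mathcomp Require Import all_boot.
Require Import Defs.

Set Implicit Arguments.
Unset Strict Implicit.
Unset Printing Implicit Defensive.

Local Notation "x ~= y" := (JMeq x y) (at level 70).

(** * Composition of a binary morphism with a pair whose second member is unary *)

Section BinaryComposition.
Variable M : multicategory.

Definition comp2 (A1 A2 B : M) G1 A (f : mor [:: A1; A2] B) (g : mor G1 A1)
    (h : mor [:: A] A2) : mor (G1 ++ [:: A]) B :=
  multicomp f (hcons g (hone h)).

Lemma comp11m G (A : M) (g : mor G A) : comp1 (idm A) g = g.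
Proof. exact: multicomp1m. Qed.

Lemma comp1m1 (A B : M) (f : mor [:: A] B) : comp1 f (idm A) = f.
Proof.
apply: cast_domP; rewrite -[X in _ ~= X]multicompm1.
exact: JMeq_sym (cast_dom_JMeq _ _).
Qed.

Lemma comp2m1 (A1 A2 B : M) (f : mor [:: A1; A2] B) :
  comp2 f (idm A1) (idm A2) = f.
Proof.
apply: JMeq_eq; rewrite -[X in _ ~= X]multicompm1.
exact: JMeq_sym (cast_dom_JMeq _ _).
Qed.

Lemma comp1_comp2 (A1 A2 B C : M) G A (k : mor [:: B] C) (f : mor [:: A1; A2] B)
    (g : mor G A1) (h : mor [:: A] A2) :
  comp1 k (comp2 f g h) = comp2 (comp1 k f) g h.
Proof. exact: (comp1_multicomp k f (hcons g (hone h))). Qed.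

Lemma comp2_comp2 (A1 A2 B C1 C2 : M) G A (f : mor [:: A1; A2] B)
    (g : mor [:: C1] A1) (h : mor [:: C2] A2) (k : mor G C1) (l : mor [:: A] C2) :
  comp2 (comp2 f g h) k l = comp2 f (comp1 g k) (comp1 h l).
Proof.
apply: JMeq_eq.
apply: (JMeq_trans
  (multicompA_JMeq f (hcons g (hone h)) (hcons (hone k) (hone (hone l))))).
refine (multicomp_JMeq (gs' := hcons (comp1 g k) (hone (comp1 h l))) _ _ _ _) => //=.
  by rewrite cats0.
apply: hcons_JMeq => //; first exact: cats0.
  exact: JMeq_sym (comp1_JMeq g k).
by apply: hcons_JMeq => //; exact: JMeq_sym (comp1_JMeq h l).
Qed.

(** Associativity again, but the domain of the right side is a [flatten] that equals [As ++ [:: A]]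
    only provably, whence [~=]. *)
Lemma comp2_precomp (A1 A2 B : M) (As : seq M) A (f : mor [:: A1; A2] B)
    (g : mor As A1) (h : mor [:: A] A2) us (l : mor [:: A] A) :
  comp2 f (precomp g us) (comp1 h l)
  ~= multicomp (comp2 f g h) (hcat us (hone l)).
Proof.
apply: JMeq_sym.
apply: (JMeq_trans
  (multicompA_JMeq f (hcons g (hone h)) (hcons us (hone (hone l))))).
refine (multicomp_JMeq
  (gs' := hcons (precomp g us) (hone (comp1 h l))) _ _ _ _) => //=.
  by rewrite flatten_seq1.
apply: hcons_JMeq => //; first exact: flatten_seq1.
  exact: JMeq_sym (precomp_JMeq _ _).
by apply: hcons_JMeq => //; exact: JMeq_sym (comp1_JMeq h l).
Qed.

End BinaryComposition.

(** * The exponential object and the evaluation in the splitting *)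

Section SplitExponential.
Variables (M : multicategory) (E : exponentials M).
Variable Lam : forall G A B, mor (G ++ [:: A]) B -> mor G (ihom E A B).
Hypothesis LamK : forall G A B (f : mor (G ++ [:: A]) B),
  comp2 (ev E A B) (Lam f) (idm A) = f.
Hypothesis Lam_nat :
  forall Gs G A B (g : mor (G ++ [:: A]) B) (fs : hlist mor Gs G),
    Lam (cast_dom (flatten_cat1 Gs [:: A]) (multicomp g (hcat fs (hone (idm A)))))
    = multicomp (Lam g) fs.

Lemma Lam_JMeq G G' A B (f : mor (G ++ [:: A]) B) (f' : mor (G' ++ [:: A]) B) :
  G = G' -> f ~= f' -> Lam f ~= Lam f'.
Proof. by move=> e; subst=> h; rewrite (JMeq_eq h). Qed.

(** Naturality of [Lam] for the one-member family [hone k], whose domain is [G ++ [::]] rather than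
    [G]. *)
Lemma Lam_comp2 G C A B (g : mor [:: C; A] B) (k : mor G C) :
  Lam (G := G) (comp2 g k (idm A)) = comp1 (Lam (G := [:: C]) g) k.
Proof.
apply: JMeq_eq; apply: JMeq_sym; apply: (JMeq_trans (comp1_JMeq _ _)).
rewrite -Lam_nat; apply: Lam_JMeq; first by rewrite /= cats0.
exact: cast_dom_JMeq.
Qed.

Variables X Y : idempotent M.
Let A := car X.
Let B := car Y.
Let a : mor [:: A] A := idem X.
Let b : mor [:: B] B := idem Y.

Definition split_ev_mor : mor [:: ihom E A B; A] B :=
  comp1 b (comp2 (ev E A B) (idm (ihom E A B)) a).

Definition split_ihom_idem : mor [:: ihom E A B] (ihom E A B) :=
  Lam (G := [:: ihom E A B]) split_ev_mor.

Local Notation t := split_ev_mor.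
Local Notation e := split_ihom_idem.

Lemma split_ev_comp2 G C (g : mor G (ihom E A B)) (h : mor [:: C] A) :
  comp2 t g h = comp1 b (comp2 (ev E A B) g (comp1 a h)).
Proof. by rewrite -comp1_comp2 comp2_comp2 comp11m. Qed.

(** Since [e] is [Lam t], the beta law turns [ev] o ([e], 1) into [t]; then compose with ([g],
    [h]). *)
Lemma ev_split_ihom_idem G C (g : mor G (ihom E A B)) (h : mor [:: C] A) :
  comp2 (ev E A B) (comp1 e g) h = comp2 t g h.
Proof. by rewrite -[h in LHS]comp11m -comp2_comp2 LamK. Qed.

Lemma idem_split_ev G C (g : mor G (ihom E A B)) (h : mor [:: C] A) :
  comp1 b (comp2 t g h) = comp2 t g h.
Proof. by rewrite !split_ev_comp2 comp1A idemK. Qed.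

Lemma split_ev_idem G (g : mor G (ihom E A B)) : comp2 t g a = comp2 t g (idm A).
Proof. by rewrite !split_ev_comp2 idemK comp1m1. Qed.

(** Replacing [ev] o ([e] o [g], -) by [t] o ([g], -) inside [t] only duplicates [b] and [a], which
    are idempotent. *)
Lemma split_ev_ihom_idem G C (g : mor G (ihom E A B)) (h : mor [:: C] A) :
  comp2 t (comp1 e g) h = comp2 t g h.
Proof.
by rewrite split_ev_comp2 ev_split_ihom_idem idem_split_ev 2!split_ev_comp2
  comp1A idemK.
Qed.

Lemma Lam_split_ev G (g : mor G (ihom E A B)) : Lam (comp2 t g a) = comp1 e g.
Proof. by rewrite split_ev_idem Lam_comp2. Qed.

(** [e] o [e] is [Lam] of [t] o ([e], [a]); as [t] absorbs [e], this is [Lam] of [t] o (1, [a]),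
    that is [e]. *)
Lemma split_ihom_idemK : comp1 e e = e.
Proof.
by rewrite -Lam_split_ev -[e in comp2 t e]comp1m1 split_ev_ihom_idem
  Lam_split_ev comp1m1.
Qed.

Definition split_ihom : idempotent M := Idempotent split_ihom_idemK.

Lemma split_ev_subproof :
  comp1 b (precomp t (idems [:: split_ihom; X])) = t.
Proof.
have -> : precomp t (idems [:: split_ihom; X]) = t.
  (* Expand [t] = [t] o (1, 1) = [t] o (1, [a]) = [t] o ([e], [a]). *)
  apply: cast_domP; rewrite -[X in _ ~= X]comp2m1 -split_ev_idem.
  rewrite -(split_ev_ihom_idem (idm _)) comp1m1; exact: JMeq_refl.
by rewrite comp1A idemK.
Qed.

Definition split_ev : split_mor [:: split_ihom; X] Y := exist _ t split_ev_subproof.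

(** * Transposition in the splitting, inverse to evaluation *)

Definition split_Lam_mor (G : seq (idempotent M)) (f : split_mor (G ++ [:: X]) Y) :
    mor (map (@car M) G) (ihom E A B) :=
  comp1 e (precomp (Lam (cast_dom (map_cat (@car M) G [:: X]) (sval f))) (idems G)).

Lemma split_Lam_subproof G (f : split_mor (G ++ [:: X]) Y) :
  comp1 e (precomp (split_Lam_mor f) (idems G)) = split_Lam_mor f.
Proof.
by rewrite /split_Lam_mor -comp1_precomp precomp_idems comp1A split_ihom_idemK.
Qed.

Definition split_Lam G (f : split_mor (G ++ [:: X]) Y) : split_mor G split_ihom :=
  exist _ (split_Lam_mor f) (split_Lam_subproof f).

Definition split_eval G (g : split_mor G split_ihom) : split_mor (G ++ [:: X]) Y :=
  split_comp split_ev (hcons g (hone (split_id X))).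

(** The identity of [X] in the splitting is [a], which therefore fills the second slot. *)
Lemma sval_split_eval G (g : split_mor G split_ihom) :
  sval (split_eval g) ~= comp2 t (sval g) a.
Proof. exact: (sval_split_comp split_ev (hcons g (hone (split_id X)))). Qed.

Lemma split_evalK G : cancel (@split_eval G) (@split_Lam G).
Proof.
move=> g; apply: split_mor_inj; rewrite /= /split_Lam_mor.
have -> : cast_dom (map_cat (@car M) G [:: X]) (sval (split_eval g))
    = comp2 t (sval g) a.
  by apply: cast_domP; exact: sval_split_eval.
(* What remains is [g] composed with [e] and the idempotents of [G], all absorbed by a morphism of
   the splitting. *)
by rewrite Lam_split_ev (split_mor_idl g) (split_mor_idr g) (split_mor_idl g).
Qed.

Lemma split_LamK G : cancel (@split_Lam G) (@split_eval G).
Proof.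
move=> f; apply: split_mor_inj; apply: JMeq_eq.
apply: (JMeq_trans (sval_split_eval _)); rewrite /= /split_Lam_mor.
set f' := cast_dom _ _.
have f'E : f' ~= sval f by exact: cast_dom_JMeq.
(* [t] absorbs the outer [e] of the transpose, leaving [b] o [ev] o (-, [a]). *)
rewrite split_ev_ihom_idem split_ev_comp2 idemK.
(* By associativity and the beta law the left side is [f'] composed with the idempotents of [G] and
   [a], which fix [f]. *)
have f'K : comp2 (ev E A B) (precomp (Lam f') (idems G)) a = f'.
  apply: JMeq_eq; rewrite -[X in comp2 _ _ X]comp11m.
  apply: (JMeq_trans (comp2_precomp _ _ _ _ _)); rewrite LamK.
  apply: JMeq_sym; apply: (JMeq_trans f'E); rewrite -[X in X ~= _]split_mor_idr.
  apply: (JMeq_trans (precomp_JMeq _ _)).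
  apply: multicomp_JMeq; rewrite ?map_cat //; first exact: JMeq_sym.
  exact: idems_cat.
rewrite f'K /f' comp1_cast split_mor_idl; exact: cast_dom_JMeq.
Qed.

End SplitExponential.

Theorem lemma9 (M : multicategory) (E : exponentials M) (hE : semi_closed E) :
  exists E' : exponentials (Split M), closed E'.
Proof.
case: hE => Lam [LamK Lam_nat].
exists (@Exponentials (Split M) _ (split_ev LamK Lam_nat)) => G A B.
(* [eval_with] for this evaluation is convertible to [split_eval]. *)
by exists (@split_Lam _ _ _ LamK Lam_nat A B G);
  [exact: split_evalK | exact: split_LamK].
Qed.
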